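(* Let $h=(h_{ijk})_{1\le i,j,k\le3}$ be a symmetric trace-free cubic form on a Euclidean three-space. With $S_{ij}=\sum_{a,b}h_{abi}h_{abj}$, $s=\operatorname{tr}S$, $q=\operatorname{tr}(S^2)$ and $r=\operatorname{tr}(S^3)$, one has $$s^3+3sq-10r\ge0,$$ $$-4s^3+17sq-15r\ge0 .$$
   Context: The components $h_{ijk}$ are real, taken with respect to an orthonormal basis, totally symmetric in $i,j,k$, and trace-free means $\sum_ih_{iik}=0$ for every $k$. $S=(S_{ij})$ is the resulting symmetric $3\times3$ matrix. *)

(* Defs.v *)
From mathcomp Require Import all_boot all_order all_algebra.
From mathcomp Require Import reals.

Set Implicit Arguments.
Unset Strict Implicit.
Unset Printing Implicit Defensive.

Import GRing.Theory Num.Theory.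
Local Open Scope ring_scope.

(* A cubic form on Euclidean three-space is given by its components
   h i j k = h(e_i, e_j, e_k) in an orthonormal basis. *)
Definition cubic_components (R : realType) := 'I_3 -> 'I_3 -> 'I_3 -> R.

(* These two transpositions generate all permutations of the three indices. *)
Definition totally_symmetric (R : realType) (h : cubic_components R) : Prop :=
  (forall i j k, h i j k = h j i k) /\ (forall i j k, h i j k = h i k j).

Definition trace_free (R : realType) (h : cubic_components R) : Prop :=
  forall k, \sum_i h i i k = 0.

Definition Smx (R : realType) (h : cubic_components R) : 'M[R]_3 :=
  \matrix_(i, j) \sum_a \sum_b h a b i * h a b j.

(* Main.v *)
(** Write [H(x) = h(x,x,.)], so that [h(x,x,x) = x.H(x)], and let
    [v_k = \sum_ij S_ij h_ijk].  The sextic rotation invariants of [h] are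
    spanned by [s^3], [s q] and [r], and norms of polynomial covariants of [h]
    provide nonnegative ones.  The quartic form [det (x, S x, H(x))] has squared
    norm [(-4 s^3 + 17 s q - 15 r) / 12].  The other invariant
    [s^3 + 3 s q - 10 r] is not a sum of squares, but its product with [s] is a
    positive combination of the squared norms of the cubic form
    [det (x, v, H(x))] and of the harmonic part of the quartic form
    [(x.S x)^2 - s |H(x)|^2 + (17/20) h(x,x,x) (v.x)].
    Both of these vanish at [Re (x + i y)^3] and at the axially symmetric
    harmonic cubic, as they must, since [s^3 + 3 s q - 10 r] does. *)
Require Import Defs.
From mathcomp Require Import all_boot all_order all_algebra ring.
From mathcomp Require Import reals.

Set Implicit Arguments.
Unset Strict Implicit.
Unset Printing Implicit Defensive.

Import GRing.Theory Num.Theory.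
Local Open Scope ring_scope.

(* Indices are natural numbers below 3, so that closed components reduce by
   computation to polynomials that [ring] can read. *)
Section HarmonicCubic.

Variables (R : comRingType) (a b c d e f g : R).

Definition sum3 (F : nat -> R) : R := F 0%N + F 1%N + F 2%N.

Definition cub (i j k : nat) : R :=
  nth 0 (nth [::] (nth [::]
    [:: [:: [:: a; b; c]; [:: b; d; e]; [:: c; e; - a - d]];
        [:: [:: b; d; e]; [:: d; f; g]; [:: e; g; - b - f]];
        [:: [:: c; e; - a - d]; [:: e; g; - b - f];
            [:: - a - d; - b - f; - c - g]]] i) j) k.

Definition gram i j := sum3 (fun k => sum3 (fun l => cub k l i * cub k l j)).
Definition gram_tr1 := sum3 (fun i => gram i i).
Definition gram_tr2 := sum3 (fun i => sum3 (fun j => gram i j * gram j i)).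
Definition gram_tr3 :=
  sum3 (fun i => sum3 (fun j => sum3 (fun k => gram i j * gram j k * gram k i))).

Definition succ3 (i : nat) : nat := nth 0%N [:: 1; 2; 0]%N i.

(* [twist] is [\sum_ab eps_kab S_al h_bmn]. *)
Definition twist k l m n :=
  gram (succ3 k) l * cub (succ3 (succ3 k)) m n
  - gram (succ3 (succ3 k)) l * cub (succ3 k) m n.

(* 12 times the coefficients of [det (x, S x, H(x))]. *)
Definition twist_sym i j k l :=
  twist i j k l + twist i k j l + twist i l j k
  + twist j i k l + twist j k i l + twist j l i k
  + twist k i j l + twist k j i l + twist k l i j
  + twist l i j k + twist l j i k + twist l k i j.

Lemma twist_sym_norm :
  12 * (- 4 * gram_tr1 ^+ 3 + 17 * gram_tr1 * gram_tr2 - 15 * gram_tr3) =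
  sum3 (fun i => sum3 (fun j => sum3 (fun k => sum3 (fun l =>
    twist_sym i j k l ^+ 2)))).
Proof.
cbv [twist_sym twist succ3 gram_tr1 gram_tr2 gram_tr3 gram sum3 cub nth].
ring.
Qed.

Definition contr k := sum3 (fun i => sum3 (fun j => gram i j * cub i j k)).

Definition cross k l m :=
  contr (succ3 k) * cub (succ3 (succ3 k)) l m
  - contr (succ3 (succ3 k)) * cub (succ3 k) l m.

(* 3 times the coefficients of [det (x, v, H(x))]. *)
Definition cross_sym k l m := cross k l m + cross l k m + cross m k l.

Definition gram_pair i j k l :=
  gram i j * gram k l - gram_tr1 * sum3 (fun m => cub i j m * cub k l m).

(* 240 times the coefficients of
   [(x.S x)^2 - s |H(x)|^2 + (17/20) h(x,x,x) (v.x)]. *)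
Definition quart i j k l :=
  80 * (gram_pair i j k l + gram_pair i k j l + gram_pair i l j k)
  + 51 * (contr i * cub j k l + contr j * cub i k l
          + contr k * cub i j l + contr l * cub i j k).

(* The pairings with the nine real spherical harmonics of degree four, weighted
   so that the sum is a multiple of the squared norm of the harmonic part. *)
Definition quart_harmonic_norm :=
  (8 * quart 2 2 2 2 - 24 * (quart 0 0 2 2 + quart 1 1 2 2)
   + 3 * (quart 0 0 0 0 + 2 * quart 0 0 1 1 + quart 1 1 1 1)) ^+ 2
  + 40 * (4 * quart 0 2 2 2 - 3 * (quart 0 0 0 2 + quart 0 1 1 2)) ^+ 2
  + 40 * (4 * quart 1 2 2 2 - 3 * (quart 0 0 1 2 + quart 1 1 1 2)) ^+ 2
  + 20 * (6 * (quart 0 0 2 2 - quart 1 1 2 2)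
          - (quart 0 0 0 0 - quart 1 1 1 1)) ^+ 2
  + 80 * (6 * quart 0 1 2 2 - (quart 0 0 0 1 + quart 0 1 1 1)) ^+ 2
  + 280 * (quart 0 0 0 2 - 3 * quart 0 1 1 2) ^+ 2
  + 280 * (3 * quart 0 0 1 2 - quart 1 1 1 2) ^+ 2
  + 35 * (quart 0 0 0 0 - 6 * quart 0 0 1 1 + quart 1 1 1 1) ^+ 2
  + 560 * (quart 0 0 0 1 - quart 0 1 1 1) ^+ 2.

(* The coefficients are kept factored because numerals are unary. *)
Lemma cross_sym_quart_norm :
  42 * 240 ^+ 2 * (gram_tr1
    * (gram_tr1 ^+ 3 + 3 * gram_tr1 * gram_tr2 - 10 * gram_tr3)) =
  42 * 720 * 93
    * sum3 (fun i => sum3 (fun j => sum3 (fun k => cross_sym i j k ^+ 2)))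
  + quart_harmonic_norm.
Proof.
cbv [quart_harmonic_norm quart gram_pair cross_sym cross contr succ3
     gram_tr1 gram_tr2 gram_tr3 gram sum3 cub nth].
ring.
Qed.

End HarmonicCubic.

Lemma sum3_ge0 (R : realDomainType) (F : nat -> R) :
  (forall i, 0 <= F i) -> 0 <= sum3 F.
Proof. by move=> F_ge0; rewrite !addr_ge0. Qed.

Local Notation x0 := (@Ordinal 3 0 isT).
Local Notation x1 := (@Ordinal 3 1 isT).
Local Notation x2 := (@Ordinal 3 2 isT).

Lemma sum_ordinal3 (V : nmodType) (F : 'I_3 -> V) :
  \sum_i F i = F x0 + F x1 + F x2.
Proof.
rewrite !big_ord_recl big_ord0 addr0 addrA.
by congr (F _ + F _ + F _); apply: val_inj.
Qed.

Lemma ordinal3P (i : 'I_3) : [\/ i = x0, i = x1 | i = x2].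
Proof.
by case: i => [[|[|[|i]]] lti] //; [apply: Or31|apply: Or32|apply: Or33];
  apply: val_inj.
Qed.

Lemma mxtrace_sqr (R : pzRingType) n (M : 'M[R]_n) :
  \tr (M ^+ 2) = \sum_i \sum_j M i j * M j i.
Proof. by rewrite expr2; apply: eq_bigr => i _; rewrite mxE. Qed.

Lemma mxtrace_cube (R : pzRingType) n (M : 'M[R]_n) :
  \tr (M ^+ 3) = \sum_i \sum_j \sum_k M i j * M j k * M k i.
Proof.
rewrite exprS expr2; apply: eq_bigr => i _; rewrite mxE; apply: eq_bigr => j _.
by rewrite mxE mulr_sumr; apply: eq_bigr => k _; rewrite mulrA.
Qed.

Section Components.

Variables (R : realType) (h : cubic_components R).
Hypotheses (hsym : totally_symmetric h) (htf : trace_free h).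

Let a := h x0 x0 x0.
Let b := h x0 x0 x1.
Let c := h x0 x0 x2.
Let d := h x0 x1 x1.
Let e := h x0 x1 x2.
Let f := h x1 x1 x1.
Let g := h x1 x1 x2.

Lemma components_cub i j k : h i j k = cub a b c d e f g i j k.
Proof.
have [hl hr] := hsym.
have h22 l : h x2 x2 l = - h x0 x0 l - h x1 x1 l.
  have /eqP := htf l; rewrite sum_ordinal3 addrC addr_eq0 opprD.
  by move/eqP.
have h010 : h x0 x1 x0 = b by apply: hr.
have h020 : h x0 x2 x0 = c by apply: hr.
have h021 : h x0 x2 x1 = e by apply: hr.
have h101 : h x1 x0 x1 = d by apply: hl.
have h110 : h x1 x1 x0 = d by rewrite (hr x1).
have h121 : h x1 x2 x1 = g by apply: hr.
have h220 : h x2 x2 x0 = - a - d by rewrite h22 h110.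
have h221 : h x2 x2 x1 = - b - f by rewrite h22.
have h022 : h x0 x2 x2 = - a - d by rewrite hl hr.
have h122 : h x1 x2 x2 = - b - f by rewrite hl hr.
case: (ordinal3P i) => ->; case: (ordinal3P j) => ->;
  case: (ordinal3P k) => ->; rewrite /cub //= 1?hl //.
all: by rewrite hr hl.
Qed.

Lemma Smx_gram i j : Smx h i j = gram a b c d e f g i j.
Proof. by rewrite mxE !sum_ordinal3 !components_cub. Qed.

Lemma tr_Smx : \tr (Smx h) = gram_tr1 a b c d e f g.
Proof. by rewrite /mxtrace sum_ordinal3 !Smx_gram. Qed.

Lemma tr_Smx2 : \tr (Smx h ^+ 2) = gram_tr2 a b c d e f g.
Proof. by rewrite mxtrace_sqr !sum_ordinal3 !Smx_gram. Qed.

Lemma tr_Smx3 : \tr (Smx h ^+ 3) = gram_tr3 a b c d e f g.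
Proof. by rewrite mxtrace_cube !sum_ordinal3 !Smx_gram. Qed.

End Components.

Lemma Smx_diag_ge0 (R : realType) (h : cubic_components R) i : 0 <= Smx h i i.
Proof.
rewrite mxE; apply: sumr_ge0 => k _; apply: sumr_ge0 => l _.
by rewrite -expr2 sqr_ge0.
Qed.

Lemma tr_Smx_eq0 (R : realType) (h : cubic_components R) :
  \tr (Smx h) = 0 -> Smx h = 0.
Proof.
move=> /psumr_eq0P S0; apply/matrixP => i j.
have := S0 (fun i _ => Smx_diag_ge0 h i) i isT; rewrite !mxE => /psumr_eq0P h0.
rewrite big1 // => k _; rewrite big1 // => l _.
have {}h0 : \sum_l h k l i * h k l i = 0.
  by apply: h0 => // m _; apply: sumr_ge0 => n _; rewrite -expr2 sqr_ge0.
have /eqP : h k l i * h k l i = 0.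
  by apply: (psumr_eq0P _ h0) => // n _; rewrite -expr2 sqr_ge0.
by rewrite -expr2 sqrf_eq0 => /eqP ->; rewrite mul0r.
Qed.

Theorem lemma4p1 (R : realType) (h : cubic_components R)
    (hsym : totally_symmetric h) (htf : trace_free h) :
  let S := Smx h in
  let s := \tr S in
  let q := \tr (S ^+ 2) in
  let r := \tr (S ^+ 3) in
  0 <= s ^+ 3 + 3 * s * q - 10 * r /\
  0 <= - 4 * s ^+ 3 + 17 * s * q - 15 * r.
Proof.
move=> S s q r; split; last first.
  have twelve_gt0 : 0 < 12 :> R by rewrite ltr0n.
  rewrite -(pmulr_rge0 _ twelve_gt0) /s /q /r /S.
  rewrite tr_Smx // tr_Smx2 // tr_Smx3 // twist_sym_norm.
  by do 4![apply: sum3_ge0 => ?]; apply: sqr_ge0.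
have : 0 <= s by apply: sumr_ge0 => i _; apply: Smx_diag_ge0.
rewrite le0r => /orP[/eqP s0 | s_gt0].
  have S0 : S = 0 by apply: tr_Smx_eq0.
  by rewrite /r /q s0 S0 !expr0n /= mxtrace0 !mulr0 addr0 subr0.
have coeff_gt0 : 0 < 42 * 240 ^+ 2 :> R by rewrite mulr_gt0 ?exprn_gt0 ?ltr0n.
rewrite -(pmulr_rge0 _ s_gt0) -(pmulr_rge0 _ coeff_gt0) /s /q /r /S.
rewrite tr_Smx // tr_Smx2 // tr_Smx3 // cross_sym_quart_norm addr_ge0 //.
  apply: mulr_ge0; first by rewrite !mulr_ge0 ?ler0n.
  by do 3![apply: sum3_ge0 => ?]; apply: sqr_ge0.
by rewrite !addr_ge0 ?sqr_ge0 // mulr_ge0 ?sqr_ge0 ?ler0n.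
Qed.
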